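(* Under the misère-play convention, there is an infinite number (with respect to distinguishability) of absolute universes strictly between the dead-ending universe $\mathbb{E}$ and the full space $\Omega$. That is, there is an infinite family $\mathcal F$ of absolute universes such that every $\mathbb{U}\in\mathcal F$ satisfies $\mathbb{E}\subseteq\mathbb{U}\subseteq\Omega$, $\mathbb{U}$ is a proper extension of $\mathbb{E}$ and $\Omega$ is a proper extension of $\mathbb{U}$; and of any two different members of $\mathcal F$ one is a proper extension of the other.
   Context: Game forms: $\Omega$ is the set of all short (finite, loop-free) partizan game forms $G=\{G^{\mathcal L}\mid G^{\mathcal R}\}$, built recursively from $\mathbf 0=\{\varnothing\mid\varnothing\}$, where $G^{\mathcal L}, G^{\mathcal R}$ are finite (possibly empty) sets of previously built forms (the Left and Right options). Forms are not identified under any equivalence. The disjunctive sum is $G+H=\{G^{\mathcal L}+H,\,G+H^{\mathcal L}\mid G^{\mathcal R}+H,\,G+H^{\mathcal R}\}$, and the conjugate of $G$ is obtained by recursively swapping the roles of Left and Right. Universe: a set $\mathbb{U}\subseteq\Omega$ is a universe if $\mathbf 0\in\mathbb{U}$ and $\mathbb{U}$ is closed under disjunctive sum, under conjugation, and under taking options. It is parental if for all finite non-empty sets $\mathcal G,\mathcal H\subseteq\mathbb{U}$ the form $\{\mathcal G\mid\mathcal H\}$ belongs to $\mathbb{U}$. An absolute universe is a parental universe (the further requirement of ''outcome saturation'' is a consequence of parentality). Dead-ending: $G$ is dead-ending if whenever, in a position reachable from $G$ (including $G$ itself) by any sequence of moves, a player has no move, that player also has no move after any sequence of moves by the other player from that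 position; $\mathbb{E}$ is the universe of all dead-ending forms. Misère-play: players alternate, and a player who cannot move on their turn wins. The outcome $o(G)\in\{\mathscr L,\mathscr R,\mathscr N,\mathscr P\}$ records whether, under optimal play, Left wins no matter who starts, Right wins no matter who starts, the next (starting) player wins, or the previous (second) player wins. Distinguishability: for a universe $\mathbb{U}$, forms $G,H\in\mathbb{U}$ are distinguishable modulo $\mathbb{U}$ if there is $X\in\mathbb{U}$ with $o(G+X)\neq o(H+X)$. For universes $\mathbb{U}\subseteq\mathbb{U}'$, $\mathbb{U}'$ is a proper extension of $\mathbb{U}$ if there is $G\in\mathbb{U}'$ such that for all $H\in\mathbb{U}$, $G$ and $H$ are distinguishable modulo $\mathbb{U}'$. *)

(* Defs.v *)
From HB Require Import structures.
From Stdlib Require List.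
From Stdlib Require Import Relation_Operators.
From mathcomp Require Import all_boot.
From mathcomp Require Import finmap.
From mathcomp Require Import mathcomp_extra boolp classical_sets.
From mathcomp Require Import functions cardinality.

Set Implicit Arguments.
Unset Strict Implicit.
Unset Printing Implicit Defensive.

Local Open Scope fset_scope.

(* Game forms whose sets of options are genuine finite sets.  A form is a     *)
(* finitely branching tree in which every list of options is the canonical    *)
(* enumeration of a {fset _}; hence two forms are equal exactly when they     *)
(* have the same set of Left options and the same set of Right options        *)
(* (form_ext, left_mkform, right_mkform, form_eta below).                     *)

Inductive tree : Type := Node of seq tree & seq tree.

Lemma tree_ind' (P : tree -> Prop) :
  (forall l r, (forall t, List.In t l -> P t) -> (forall t, List.In t r -> P t) ->
     P (Node l r)) ->
  forall t, P t.
Proof.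
move=> IH; fix rec 1 => -[l r]; apply: IH.
- elim: l => [t []|u l IHl t [<-|]]; [exact: rec u|exact: IHl].
- elim: r => [t []|u r IHr t [<-|]]; [exact: rec u|exact: IHr].
Qed.

Definition ltree t := let: Node l _ := t in l.
Definition rtree t := let: Node _ r := t in r.

Fixpoint encode_tree (t : tree) : GenTree.tree void :=
  let: Node l r := t in
  GenTree.Node 0 [:: GenTree.Node 0 (map encode_tree l);
                     GenTree.Node 0 (map encode_tree r)].

Fixpoint decode_tree (g : GenTree.tree void) : tree :=
  match g with
  | GenTree.Node _ [:: GenTree.Node _ l; GenTree.Node _ r] =>
      Node (map decode_tree l) (map decode_tree r)
  | _ => Node [::] [::]
  end.

Lemma encode_treeK : cancel encode_tree decode_tree.
Proof.
rewrite /cancel; fix IH 1 => -[l r] /=; rewrite -!map_comp.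
by congr Node; [elim: l | elim: r] => //= t s ->; rewrite IH.
Qed.

HB.instance Definition _ := Choice.copy tree (can_type encode_treeK).

Fixpoint canonical_tree (t : tree) : bool :=
  let: Node l r := t in
  [&& canonical_keys l, canonical_keys r,
      all canonical_tree l & all canonical_tree r].

Definition form : Type := {t : tree | canonical_tree t}.

HB.instance Definition _ := Choice.on form.

Definition left_options (G : form) : {fset form} :=
  [fset X in pmap insub (ltree (val G))].
Definition right_options (G : form) : {fset form} :=
  [fset X in pmap insub (rtree (val G))].

Definition mktree (A B : {fset form}) : tree :=
  Node (sort_keys (map val A)) (sort_keys (map val B)).

Lemma mktree_canonical (A B : {fset form}) : canonical_tree (mktree A B).
Proof.
rewrite /= !canonical_sort_keys /=.
by apply/andP; split; apply/allP => t; rewrite sort_keysE => /mapP[X _ ->];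
  exact: valP.
Qed.

(* The form {A | B}. *)
Definition mkform (A B : {fset form}) : form :=
  exist _ (mktree A B) (mktree_canonical A B).

Lemma in_left G X : (X \in left_options G) = (val X \in ltree (val G)).
Proof. by rewrite /left_options !inE /= mem_pmap_sub. Qed.

Lemma in_right G X : (X \in right_options G) = (val X \in rtree (val G)).
Proof. by rewrite /right_options !inE /= mem_pmap_sub. Qed.

Lemma left_mkform A B : left_options (mkform A B) = A.
Proof.
apply/fsetP => X; rewrite in_left /= sort_keysE mem_map //; exact: val_inj.
Qed.

Lemma right_mkform A B : right_options (mkform A B) = B.
Proof.
apply/fsetP => X; rewrite in_right /= sort_keysE mem_map //; exact: val_inj.
Qed.

Lemma form_eta G : mkform (left_options G) (right_options G) = G.
Proof.
apply/val_inj; case: G => -[l r] /= cG; rewrite /mktree.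
have /and4P[/eqP cl /eqP cr /allP al /allP ar] := cG.
congr Node; [rewrite -[RHS]cl | rewrite -[RHS]cr]; apply/eq_sort_keys => t;
  apply/mapP/idP => [[X + ->]|tin].
- by rewrite in_left.
- by exists (exist _ t (al _ tin)); rewrite ?in_left.
- by rewrite in_right.
- by exists (exist _ t (ar _ tin)); rewrite ?in_right.
Qed.

Lemma form_ext G H : left_options G = left_options H -> right_options G = right_options H ->
  G = H.
Proof. by move=> eL eR; rewrite -(form_eta G) eL eR form_eta. Qed.

Lemma form_ind' (P : form -> Prop) :
  (forall G, (forall X, X \in left_options G -> P X) ->
             (forall X, X \in right_options G -> P X) -> P G) ->
  forall G, P G.
Proof.
move=> IH; suff H : forall t (ct : canonical_tree t), P (exist _ t ct) by case.
apply: tree_ind' => l r Pl Pr ct.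
have mem_In s u : u \in s -> @List.In tree u s.
  by elim: s => //= v s IHs; rewrite inE => /predU1P[->|/IHs]; [left|right].
by apply: IH => -[u cu]; rewrite ?in_left ?in_right /= => uin; [apply: Pl|apply: Pr];
  exact: mem_In.
Qed.

Definition zero_form : form := mkform fset0 fset0.

(* Disjunctive sum and conjugate are defined by structural recursion on the   *)
(* underlying trees; add_formE and conjugate_formE give the usual recursive   *)
(* equations.                                                                 *)

Fixpoint add_tree (s : tree) : tree -> form :=
  fix add_s (t : tree) : form :=
    mkform
      [fset X in map (fun x => add_tree x t) (let: Node l _ := s in l)
                 ++ map add_s (let: Node l _ := t in l)]
      [fset X in map (fun x => add_tree x t) (let: Node _ r := s in r)
                 ++ map add_s (let: Node _ r := t in r)].

Definition add_form (G H : form) : form := add_tree (val G) (val H).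

Fixpoint conjugate_tree (t : tree) : form :=
  let: Node l r := t in
  mkform [fset X in map conjugate_tree r] [fset X in map conjugate_tree l].

Definition conjugate_form (G : form) : form := conjugate_tree (val G).

Lemma ltree_form G t : t \in ltree (val G) ->
  exists2 X, X \in left_options G & val X = t.
Proof.
move=> tin; suff ct : canonical_tree t.
  by exists (exist _ t ct); rewrite ?in_left.
by case: G tin => -[l r] /= /and4P[_ _ /allP + _]; apply.
Qed.

Lemma rtree_form G t : t \in rtree (val G) ->
  exists2 X, X \in right_options G & val X = t.
Proof.
move=> tin; suff ct : canonical_tree t.
  by exists (exist _ t ct); rewrite ?in_right.
by case: G tin => -[l r] /= /and4P[_ _ _ /allP]; apply.
Qed.

Lemma add_formE G H :
  add_form G H =
  mkform ([fset add_form X H | X in left_options G]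
            `|` [fset add_form G Y | Y in left_options H])
         ([fset add_form X H | X in right_options G]
            `|` [fset add_form G Y | Y in right_options H]).
Proof.
have -> : add_form G H =
    mkform [fset X in map (add_tree ^~ (val H)) (ltree (val G))
                      ++ map (add_tree (val G)) (ltree (val H))]
           [fset X in map (add_tree ^~ (val H)) (rtree (val G))
                      ++ map (add_tree (val G)) (rtree (val H))].
  by rewrite /add_form; case: (val G) (val H) => l r [l' r'].
congr mkform; apply/fsetP => Z; rewrite !inE /=;
  congr (_ || _); apply/mapP/imfsetP => /= -[x xin ->].
- by have [X ? <-] := ltree_form xin; exists X.
- by exists (val x); rewrite // -in_left.
- by have [X ? <-] := ltree_form xin; exists X.
- by exists (val x); rewrite // -in_left.
- by have [X ? <-] := rtree_form xin; exists X.
- by exists (val x); rewrite // -in_right.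
- by have [X ? <-] := rtree_form xin; exists X.
- by exists (val x); rewrite // -in_right.
Qed.

Lemma conjugate_formE G :
  conjugate_form G = mkform [fset conjugate_form X | X in right_options G]
                       [fset conjugate_form X | X in left_options G].
Proof.
have -> : conjugate_form G = mkform [fset X in map conjugate_tree (rtree (val G))]
                               [fset X in map conjugate_tree (ltree (val G))].
  by rewrite /conjugate_form; case: (val G).
congr mkform; apply/fsetP => Z; rewrite !inE /=;
  apply/mapP/imfsetP => /= -[x xin ->].
- by have [X ? <-] := rtree_form xin; exists X.
- by exists (val x); rewrite // -in_right.
- by have [X ? <-] := ltree_form xin; exists X.
- by exists (val x); rewrite // -in_left.
Qed.

(* Misere play.  First component: Left wins moving first; second component:   *)
(* Right wins moving first.  See left_winsE and right_winsE.                  *)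
Fixpoint wins_tree (t : tree) : bool * bool :=
  let: Node l r := t in
  (nilp l || has (fun x => ~~ (wins_tree x).2) l,
   nilp r || has (fun x => ~~ (wins_tree x).1) r).

Definition left_wins (G : form) : bool := (wins_tree (val G)).1.
Definition right_wins (G : form) : bool := (wins_tree (val G)).2.

Lemma left_winsE G :
  left_wins G <->
  left_options G = fset0 \/ exists2 X, X \in left_options G & ~~ right_wins X.
Proof.
have -> : left_wins G =
    nilp (ltree (val G)) || has (fun x => ~~ (wins_tree x).2) (ltree (val G)).
  by rewrite /left_wins; case: (val G).
split=> [/orP[/nilP l0|/hasP[x xin wx]]|[l0|[X Xin wX]]].
- by left; apply/fsetP => X; rewrite in_left l0 !inE.
- by right; have [X Xin eX] := ltree_form xin; exists X; rewrite // /right_wins eX.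
- apply/orP; left; case e: (ltree (val G)) => [//|x l].
  have xin : x \in ltree (val G) by rewrite e mem_head.
  by have [X] := ltree_form xin; rewrite l0 inE.
- by apply/orP; right; apply/hasP; exists (val X); rewrite // -in_left.
Qed.

Lemma right_winsE G :
  right_wins G <->
  right_options G = fset0 \/ exists2 X, X \in right_options G & ~~ left_wins X.
Proof.
have -> : right_wins G =
    nilp (rtree (val G)) || has (fun x => ~~ (wins_tree x).1) (rtree (val G)).
  by rewrite /right_wins; case: (val G).
split=> [/orP[/nilP r0|/hasP[x xin wx]]|[r0|[X Xin wX]]].
- by left; apply/fsetP => X; rewrite in_right r0 !inE.
- by right; have [X Xin eX] := rtree_form xin; exists X; rewrite // /left_wins eX.
- apply/orP; left; case e: (rtree (val G)) => [//|x r].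
  have xin : x \in rtree (val G) by rewrite e mem_head.
  by have [X] := rtree_form xin; rewrite r0 inE.
- by apply/orP; right; apply/hasP; exists (val X); rewrite // -in_right.
Qed.

Variant outcome_class : Type := OutL | OutR | OutN | OutP.

Definition outcome (G : form) : outcome_class :=
  match left_wins G, right_wins G with
  | true, false => OutL
  | false, true => OutR
  | true, true => OutN
  | false, false => OutP
  end.

Local Open Scope classical_set_scope.

Definition is_left_option (G X : form) : Prop := X \in left_options G.
Definition is_right_option (G X : form) : Prop := X \in right_options G.
Definition is_option (G X : form) : Prop :=
  is_left_option G X \/ is_right_option G X.

(* The players need not alternate in these sequences of moves. *)
Definition follower : form -> form -> Prop :=
  clos_refl_trans form is_option.
Definition left_follower : form -> form -> Prop :=
  clos_refl_trans form is_left_option.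
Definition right_follower : form -> form -> Prop :=
  clos_refl_trans form is_right_option.

Definition dead_ending (G : form) : Prop :=
  forall H, follower G H ->
    (left_options H = fset0 ->
       forall K, right_follower H K -> left_options K = fset0) /\
    (right_options H = fset0 ->
       forall K, left_follower H K -> right_options K = fset0).

Definition Omega : set form := [set: form].
Definition DeadEnding : set form := [set G | dead_ending G].

Definition universe (U : set form) : Prop :=
  [/\ U zero_form,
      forall G H, U G -> U H -> U (add_form G H),
      forall G, U G -> U (conjugate_form G) &
      forall G X, U G -> is_option G X -> U X].

Definition parental (U : set form) : Prop :=
  forall A B : {fset form}, A <> fset0 -> B <> fset0 ->
    [set` A] `<=` U -> [set` B] `<=` U -> U (mkform A B).

(* Outcome saturation is omitted: it follows from parentality. *)
Definition absolute_universe (U : set form) : Prop := universe U /\ parental U.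

Definition distinguishable (U : set form) (G H : form) : Prop :=
  exists2 X, U X & outcome (add_form G X) <> outcome (add_form H X).

(* V is a proper extension of U; meaningful when U and V are universes. *)
Definition proper_extension (U V : set form) : Prop :=
  U `<=` V /\ exists2 G, V G & forall H, U H -> distinguishable V G H.

(* Main.v *)
From Stdlib Require Import Relation_Operators Operators_Properties.
Require Import Defs.
From mathcomp Require Import all_boot finmap.
From mathcomp Require Import zify.
From mathcomp Require Import boolp classical_sets functions cardinality.

Set Implicit Arguments.
Unset Strict Implicit.
Unset Printing Implicit Defensive.

(* A parental universe is determined by its Left and Right ends.  Let         *)
(* [bomb N] = {|N}, a Left end in which Right can saddle Left with N moves,   *)
(* and let [bomb_universe n] be the universe whose Left ends are the sums of  *)
(* dead Left ends and bombs of size at least n; these universes decrease with *)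
(* n and contain all dead-ending forms.  For n > 0, any H in the (n+1)-st one *)
(* is distinguished from [bomb n] by some X in the n-th one:                  *)
(* - if H is not a Left end, take X = bomb M with M large: Left, moving       *)
(*   first, wins at once in bomb n + X, but Right explodes X in H + X;        *)
(* - if Right can move from the Left end H to a Left end, take the zugzwang   *)
(*   X = {M|-M}, next to which moving last wins: Right moving first loses     *)
(*   bomb n + X and wins H + X;                                               *)
(* - if H = 0, take X = -(bomb M) with M large;                               *)
(* - otherwise H is a nonempty sum of bombs of size greater than n, and with  *)
(*   X = -n, Right moving first loses bomb n + X but outlasts Left in H + X.  *)

Local Open Scope fset_scope.
Local Open Scope nat_scope.
Local Open Scope classical_set_scope.

(** In misère play spare moves are a burden, and exploding [bomb N] burdens Left with N of them. The
    bound n in [bomb_universe n] limits only which Left ends occur (and, by conjugation, which Right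
    ends). Parentality is then automatic, because {A|B} with both sides nonempty is no end, and sums
    are safe because the ends of a sum are the sums of ends.

    The universes form a decreasing chain above the dead-ending forms, so everything rests on
    [bomb_distinguishable]: next to a suitable X, [bomb n] differs in outcome from every form whose
    bombs are all larger. By monotonicity this separates any two members, and the same witness
    separates a member from the dead-ending forms below it. For separation from Omega, [bomb 1]
    serves against all members with larger index. *)

(** * Options and followers of sums and conjugates *)

Lemma in_left_add G H X : X \in left_options (add_form G H) <->
  (exists2 G', G' \in left_options G & X = add_form G' H) \/
  (exists2 H', H' \in left_options H & X = add_form G H').
Proof.
rewrite add_formE left_mkform inE; split.
  by case/orP => /imfsetP[/= Y ? ->]; [left|right]; exists Y.
by case=> -[Y ? ->]; apply/orP; [left|right]; apply/imfsetP; exists Y.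
Qed.

Lemma in_right_add G H X : X \in right_options (add_form G H) <->
  (exists2 G', G' \in right_options G & X = add_form G' H) \/
  (exists2 H', H' \in right_options H & X = add_form G H').
Proof.
rewrite add_formE right_mkform inE; split.
  by case/orP => /imfsetP[/= Y ? ->]; [left|right]; exists Y.
by case=> -[Y ? ->]; apply/orP; [left|right]; apply/imfsetP; exists Y.
Qed.

Lemma in_left_conj G X : X \in left_options (conjugate_form G) <->
  exists2 Y, Y \in right_options G & X = conjugate_form Y.
Proof.
rewrite conjugate_formE left_mkform; split; first by case/imfsetP=> /= Y; exists Y.
by case=> Y ? ->; apply/imfsetP; exists Y.
Qed.

Lemma in_right_conj G X : X \in right_options (conjugate_form G) <->
  exists2 Y, Y \in left_options G & X = conjugate_form Y.
Proof.
rewrite conjugate_formE right_mkform; split; first by case/imfsetP=> /= Y; exists Y.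
by case=> Y ? ->; apply/imfsetP; exists Y.
Qed.

Lemma fset0_notin (A : {fset form}) X : A = fset0 -> X \in A -> False.
Proof. by move=> ->; rewrite inE. Qed.

Lemma notin_fset0 (A : {fset form}) : (forall X, X \in A -> False) -> A = fset0.
Proof. by move=> A0; apply/fsetP => X; rewrite [RHS]inE; apply/negP/A0. Qed.

Lemma left_add_eq0 G H : left_options (add_form G H) = fset0 <->
  left_options G = fset0 /\ left_options H = fset0.
Proof.
split=> [/fset0_notin E|[/fset0_notin GE /fset0_notin HE]].
  split; apply: notin_fset0 => X XG; apply: E; apply/in_left_add.
  - by left; exists X.
  - by right; exists X.
by apply: notin_fset0 => X /in_left_add[[Y /GE]|[Y /HE]].
Qed.

Lemma right_add_eq0 G H : right_options (add_form G H) = fset0 <->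
  right_options G = fset0 /\ right_options H = fset0.
Proof.
split=> [/fset0_notin E|[/fset0_notin GE /fset0_notin HE]].
  split; apply: notin_fset0 => X XG; apply: E; apply/in_right_add.
  - by left; exists X.
  - by right; exists X.
by apply: notin_fset0 => X /in_right_add[[Y /GE]|[Y /HE]].
Qed.

Lemma left_conj_eq0 G :
  left_options (conjugate_form G) = fset0 <-> right_options G = fset0.
Proof.
split=> /fset0_notin E; apply: notin_fset0 => X.
  by move=> XG; apply: (E (conjugate_form X)); apply/in_left_conj; exists X.
by case/in_left_conj => Y /E.
Qed.

Lemma right_conj_eq0 G :
  right_options (conjugate_form G) = fset0 <-> left_options G = fset0.
Proof.
split=> /fset0_notin E; apply: notin_fset0 => X.
  by move=> XG; apply: (E (conjugate_form X)); apply/in_right_conj; exists X.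
by case/in_right_conj => Y /E.
Qed.

Lemma conjugate_formK : involutive conjugate_form.
Proof.
elim/form_ind' => G IHl IHr; apply: form_ext; apply/fsetP => X.
  apply/idP/idP => [/in_left_conj[_ /in_right_conj[Y YG ->] ->]|XG].
    by rewrite IHl.
  apply/in_left_conj; exists (conjugate_form X); last by rewrite IHl.
  by apply/in_right_conj; exists X.
apply/idP/idP => [/in_right_conj[_ /in_left_conj[Y YG ->] ->]|XG].
  by rewrite IHr.
apply/in_right_conj; exists (conjugate_form X); last by rewrite IHr.
by apply/in_left_conj; exists X.
Qed.

Lemma conjugate_add G H : conjugate_form (add_form G H) =
  add_form (conjugate_form G) (conjugate_form H).
Proof.
elim/form_ind': G H => G IHGl IHGr; elim/form_ind' => H IHHl IHHr.
apply: form_ext; apply/fsetP => X; apply/idP/idP.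
- case/in_left_conj=> _ /in_right_add[[Y YG ->]|[Y YH ->]] ->; apply/in_left_add.
    left; exists (conjugate_form Y); last exact: IHGr.
    by apply/in_left_conj; exists Y.
  right; exists (conjugate_form Y); last exact: IHHr.
  by apply/in_left_conj; exists Y.
- case/in_left_add=> -[_ /in_left_conj[Y YG ->] ->]; apply/in_left_conj.
    exists (add_form Y H); last by rewrite IHGr.
    by apply/in_right_add; left; exists Y.
  exists (add_form G Y); last by rewrite IHHr.
  by apply/in_right_add; right; exists Y.
- case/in_right_conj=> _ /in_left_add[[Y YG ->]|[Y YH ->]] ->; apply/in_right_add.
    left; exists (conjugate_form Y); last exact: IHGl.
    by apply/in_right_conj; exists Y.
  right; exists (conjugate_form Y); last exact: IHHl.
  by apply/in_right_conj; exists Y.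
- case/in_right_add=> -[_ /in_right_conj[Y YG ->] ->]; apply/in_right_conj.
    exists (add_form Y H); last by rewrite IHGl.
    by apply/in_left_add; left; exists Y.
  exists (add_form G Y); last by rewrite IHHl.
  by apply/in_left_add; right; exists Y.
Qed.

Lemma follower_add G H K : follower (add_form G H) K ->
  exists G' H', [/\ K = add_form G' H', follower G G' & follower H H'].
Proof.
move=> fK; have [A eA] : exists A, A = add_form G H by exists (add_form G H).
rewrite -eA in fK; elim: fK G H eA => {A K}.
- move=> A B AB G H eA; move: AB; rewrite eA.
  case=> [/in_left_add|/in_right_add] [] [Y Yin ->].
  + by exists Y, H; split => //; [apply: rt_step; left|apply: rt_refl].
  + by exists G, Y; split => //; [apply: rt_refl|apply: rt_step; left].
  + by exists Y, H; split => //; [apply: rt_step; right|apply: rt_refl].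
  + by exists G, Y; split => //; [apply: rt_refl|apply: rt_step; right].
- by move=> A G H ->; exists G, H; split=> //; apply: rt_refl.
- move=> A B C _ IH1 _ IH2 G H /IH1[G1 [H1 [/IH2[G2 [H2 [-> ? ?]]] ? ?]]].
  by exists G2, H2; split=> //; [apply: (@rt_trans _ _ _ G1)|apply: (@rt_trans _ _ _ H1)].
Qed.

Lemma follower_conj G K : follower (conjugate_form G) K ->
  exists2 G', K = conjugate_form G' & follower G G'.
Proof.
move=> fK; have [A eA] : exists A, A = conjugate_form G by exists (conjugate_form G).
rewrite -eA in fK; elim: fK G eA => {A K}.
- move=> A B AB G eA; move: AB; rewrite eA.
  case=> [/in_left_conj|/in_right_conj] [Y Yin ->]; exists Y => //; apply: rt_step.
  + by right.
  + by left.
- by move=> A G ->; exists G => //; apply: rt_refl.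
- move=> A B C _ IH1 _ IH2 G /IH1[G1 /IH2[G2 -> ?] ?].
  by exists G2 => //; apply: (@rt_trans _ _ _ G1).
Qed.

Lemma right_follower_conj G K : right_follower (conjugate_form G) K ->
  exists2 G', K = conjugate_form G' & left_follower G G'.
Proof.
move=> fK; have [A eA] : exists A, A = conjugate_form G by exists (conjugate_form G).
rewrite -eA in fK; elim: fK G eA => {A K}.
- move=> A B AB G eA; move: AB; rewrite eA.
  by case/in_right_conj=> Y Yin ->; exists Y => //; apply: rt_step.
- by move=> A G ->; exists G => //; apply: rt_refl.
- move=> A B C _ IH1 _ IH2 G /IH1[G1 /IH2[G2 -> ?] ?].
  by exists G2 => //; apply: (@rt_trans _ _ _ G1).
Qed.

(** * Winning criteria for misère play *)

Lemma left_winsP G X : X \in left_options G -> ~ right_wins X -> left_wins G.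
Proof. by move=> XG /negP nX; apply/left_winsE; right; exists X. Qed.

Lemma right_winsP G X : X \in right_options G -> ~ left_wins X -> right_wins G.
Proof. by move=> XG /negP nX; apply/right_winsE; right; exists X. Qed.

Lemma left_end_wins G : left_options G = fset0 -> left_wins G.
Proof. by move=> G0; apply/left_winsE; left. Qed.

Lemma right_end_wins G : right_options G = fset0 -> right_wins G.
Proof. by move=> G0; apply/right_winsE; left. Qed.

Lemma not_left_wins G X : X \in left_options G ->
  (forall Y, Y \in left_options G -> right_wins Y) -> ~ left_wins G.
Proof.
move=> XG GR /left_winsE[/fset0_notin/(_ XG)//|[Y YG /negP]].
by apply; apply: GR.
Qed.

Lemma not_right_wins G X : X \in right_options G ->
  (forall Y, Y \in right_options G -> left_wins Y) -> ~ right_wins G.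
Proof.
move=> XG GL /right_winsE[/fset0_notin/(_ XG)//|[Y YG /negP]].
by apply; apply: GL.
Qed.

(** * Integers, bombs and depth *)

Fixpoint pos_form (n : nat) : form :=
  if n is m.+1 then mkform [fset pos_form m] fset0 else zero_form.

Definition neg_form (n : nat) : form := conjugate_form (pos_form n).

Definition bomb (n : nat) : form := mkform fset0 [fset pos_form n].

Lemma in_left_pos n X : X \in left_options (pos_form n) <->
  exists2 m, n = m.+1 & X = pos_form m.
Proof.
case: n => [|n]; rewrite /= left_mkform ?inE; first by split=> // -[].
by split=> [/eqP|[m [->] ->]] //; exists n.
Qed.

Lemma right_pos n : right_options (pos_form n) = fset0.
Proof. by case: n => [|n]; rewrite right_mkform. Qed.

Lemma left_neg n : left_options (neg_form n) = fset0.
Proof. exact/left_conj_eq0/right_pos. Qed.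

Lemma in_right_neg n X : X \in right_options (neg_form n) <->
  exists2 m, n = m.+1 & X = neg_form m.
Proof.
split=> [/in_right_conj[_ /in_left_pos[m -> ->] ->]|[m -> ->]]; first by exists m.
by apply/in_right_conj; exists (pos_form m) => //; apply/in_left_pos; exists m.
Qed.

Lemma left_bomb n : left_options (bomb n) = fset0.
Proof. by rewrite left_mkform. Qed.

Lemma in_right_bomb n X : X \in right_options (bomb n) <-> X = pos_form n.
Proof. by rewrite right_mkform inE; split=> /eqP. Qed.

(** Levels are counted rather than moves, so [zero_form] has depth 1 and [depth H <= n] makes n
    exceed the length of every run of moves in H. *)
Fixpoint depth_tree (t : tree) : nat :=
  let: Node l r := t in
  (maxn (foldr maxn 0 (map depth_tree l)) (foldr maxn 0 (map depth_tree r))).+1.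

Definition depth (G : form) : nat := depth_tree (val G).

Lemma leq_foldr_max (s : seq tree) t :
  t \in s -> depth_tree t <= foldr maxn 0 (map depth_tree s).
Proof.
elim: s => //= u s IHs; rewrite inE => /predU1P[->|/IHs le_t]; first exact: leq_maxl.
by rewrite leq_max le_t orbT.
Qed.

Lemma depth_left G X : X \in left_options G -> depth X < depth G.
Proof.
rewrite in_left /depth; case: (val G) => l r /= /leq_foldr_max le_X.
by rewrite ltnS leq_max le_X.
Qed.

Lemma depth_right G X : X \in right_options G -> depth X < depth G.
Proof.
rewrite in_right /depth; case: (val G) => l r /= /leq_foldr_max le_X.
by rewrite ltnS leq_max le_X orbT.
Qed.

Lemma depth_gt0 G : 0 < depth G.
Proof. by rewrite /depth; case: (val G). Qed.

(* A player burdened with more moves than all the play that is left elsewhere *)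
(* never gets stuck first.                                                    *)
Lemma pos_form_overwhelms H n :
  (depth H <= n -> ~ left_wins (add_form H (pos_form n))) /\
  (depth H <= n.+1 -> right_wins (add_form H (pos_form n))).
Proof.
elim/form_ind': H n => H IHl IHr.
have rw n : depth H <= n.+1 -> right_wins (add_form H (pos_form n)).
  move=> dH; case: (EM (right_options H = fset0)) => [H0|/eqP/fset0Pn[X XH]].
    by apply: right_end_wins; apply/right_add_eq0; split; last exact: right_pos.
  apply: (@right_winsP _ (add_form X (pos_form n))).
    by apply/in_right_add; left; exists X.
  by apply: (IHr X XH n).1; have := depth_right XH; lia.
move=> n; split; last exact: rw.
case: n => [|n] dH; first by have := depth_gt0 H; lia.
apply: (@not_left_wins _ (add_form H (pos_form n))).
  by apply/in_left_add; right; exists (pos_form n) => //; apply/in_left_pos; exists n.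
move=> _ /in_left_add[[Y YH ->]|[_ /in_left_pos[m [<-] ->] ->]]; last exact: rw.
by apply: (IHl Y YH _).2; have := depth_left YH; lia.
Qed.

(** * Races to run out of moves *)

Lemma left_wins_pos_neg a b : a <= b -> left_wins (add_form (pos_form a) (neg_form b)).
Proof.
elim: a b => [|a IHa] [|b] // ab.
- by apply: left_end_wins; apply/left_add_eq0; rewrite left_mkform left_neg.
- by apply: left_end_wins; apply/left_add_eq0; rewrite left_mkform left_neg.
apply: (@left_winsP _ (add_form (pos_form a) (neg_form b.+1))).
  by apply/in_left_add; left; exists (pos_form a) => //; apply/in_left_pos; exists a.
apply: (@not_right_wins _ (add_form (pos_form a) (neg_form b))).
  by apply/in_right_add; right; exists (neg_form b) => //; apply/in_right_neg; exists b.
move=> _ /in_right_add[[Y + ->]|[_ /in_right_neg[m [<-] ->] ->]]; last exact: IHa.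
by rewrite right_pos inE.
Qed.

Lemma not_right_wins_pos_neg a b :
  a < b -> ~ right_wins (add_form (pos_form a) (neg_form b)).
Proof.
case: b => // b ab.
apply: (@not_right_wins _ (add_form (pos_form a) (neg_form b))).
  by apply/in_right_add; right; exists (neg_form b) => //; apply/in_right_neg; exists b.
move=> _ /in_right_add[[Y + ->]|[_ /in_right_neg[m [<-] ->] ->]].
  by rewrite right_pos inE.
exact: left_wins_pos_neg.
Qed.

(* Left has [a] moves and Right has [b] moves besides setting off the bombs.  *)
Inductive race : nat -> nat -> form -> Prop :=
| race_bomb n : 0 < n -> race 0 0 (bomb n)
| race_pos a : race a 0 (pos_form a)
| race_neg b : race 0 b (neg_form b)
| race_add a b a' b' G H :
    race a b G -> race a' b' H -> race (a + a') (b + b') (add_form G H).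

Lemma race_left a b G : race a b G ->
  (0 < a -> exists X, X \in left_options G) /\
  (forall X, X \in left_options G -> exists2 a', a = a'.+1 & race a' b X).
Proof.
elim=> {a b G}.
- by move=> n _; split=> // X; rewrite left_bomb inE.
- move=> a; split=> [|X /in_left_pos[m -> ->]]; last by exists m => //; apply: race_pos.
  by case: a => // a _; exists (pos_form a); apply/in_left_pos; exists a.
- by move=> b; split=> // X; rewrite left_neg inE.
move=> a b a' b' G H rG [G0 GX] rH [H0 HX]; split=> [|X].
  rewrite addn_gt0 => /orP[/G0|/H0] [X Xin].
    by exists (add_form X H); apply/in_left_add; left; exists X.
  by exists (add_form G X); apply/in_left_add; right; exists X.
case/in_left_add=> -[Y Yin ->].
  by have [m -> rY] := GX Y Yin; exists (m + a') => //; apply: race_add.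
by have [m -> rY] := HX Y Yin; exists (a + m); rewrite ?addnS //; apply: race_add.
Qed.

(** Every Right move strictly raises a - b: it either uses up one of Right's own moves or explodes a
    bomb of positive size. *)
Lemma race_right a b G X : race a b G -> X \in right_options G ->
  exists a' b', race a' b' X /\ a + b' < a' + b.
Proof.
move=> rG; elim: rG X => {a b G}.
- by move=> n n0 X /in_right_bomb ->; exists n, 0; split; [apply: race_pos|lia].
- by move=> a X; rewrite right_pos inE.
- by move=> b X /in_right_neg[m -> ->]; exists 0, m; split; [apply: race_neg|lia].
move=> a b a' b' G H rG IHG rH IHH X /in_right_add[[Y /IHG]|[Y /IHH]].
  by case=> c [d [rY lt]] ->; exists (c + a'), (d + b'); split; [apply: race_add|lia].
by case=> c [d [rY lt]] ->; exists (a + c), (b + d); split; [apply: race_add|lia].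
Qed.

(** Left's moves lower a - b by exactly one and Right's raise it by at least one. Hence a - b stays
    positive whenever Left is to move, and Left is never the first to be stuck, whatever Right
    plays. *)
Lemma race_wins a b G : race a b G ->
  (b < a -> ~ left_wins G) /\ (b <= a -> right_wins G).
Proof.
elim/form_ind': G a b => G IHl IHr a b rG; split=> ab.
  have [/(_ ltac:(lia))[X XG] GX] := race_left rG.
  apply: (not_left_wins XG) => Y YG; have [m am rY] := GX Y YG.
  by apply: (IHl Y YG _ _ rY).2; lia.
case: (EM (right_options G = fset0)) => [|/eqP/fset0Pn[X XG]]; first exact: right_end_wins.
have [c [d [rX lt]]] := race_right rG XG.
by apply: (right_winsP XG); apply: (IHr X XG _ _ rX).1; lia.
Qed.

(** * Left ends built from dead ends and bombs *)

Definition dead_left_end (G : form) : Prop :=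
  forall K, right_follower G K -> left_options K = fset0.

Inductive end_sum (n : nat) : form -> Prop :=
| end_sum_dead D : dead_left_end D -> end_sum n D
| end_sum_bomb N : n <= N -> end_sum n (bomb N)
| end_sum_add G H : end_sum n G -> end_sum n H -> end_sum n (add_form G H).

Lemma end_sum_left n G : end_sum n G -> left_options G = fset0.
Proof.
elim=> {G} [D /(_ D)|N _|G H _ G0 _ H0].
- by apply; apply: rt_refl.
- exact: left_bomb.
- exact/left_add_eq0.
Qed.

Lemma leq_end_sum m n G : m <= n -> end_sum n G -> end_sum m G.
Proof.
move=> mn; elim=> {G}; first exact: end_sum_dead.
  by move=> N nN; apply: end_sum_bomb; apply: leq_trans nN.
by move=> G H _ mG _ mH; apply: end_sum_add.
Qed.

(** Either Right can move to a Left end, or all dead summands are zero. In the latter case G is 0 or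
    a nonempty sum of bombs, and exploding one of them gives Left at least n moves. A move to a Left
    end in one summand is one in the sum, since the other summand is a Left end too. *)
Lemma end_sumP n G : 0 < n -> end_sum n G ->
  (exists2 X, X \in right_options G & left_options X = fset0) \/
  (race 0 0 G /\ (right_options G = fset0 \/
     exists2 X, X \in right_options G & exists2 a, n <= a & race a 0 X)).
Proof.
move=> n0; elim=> {G}.
- move=> D dD; case: (EM (right_options D = fset0)) => [D0|/eqP/fset0Pn[X XD]]; last first.
    by left; exists X => //; apply: dD; apply: rt_step.
  right; split; last by left.
  (* An end for both players is 0. *)
  suff -> : D = pos_form 0 by apply: race_pos.
  by apply: form_ext; rewrite ?D0 ?right_mkform //= left_mkform (dD D) //; apply: rt_refl.
- move=> N nN; right; split; first by apply: race_bomb; apply: leq_trans nN.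
  by right; exists (pos_form N); [apply/in_right_bomb|exists N => //; apply: race_pos].
move=> G H sG IHG sH IHH; have [G0 H0] := (end_sum_left sG, end_sum_left sH).
case: IHG => [[X XG X0]|[rG eG]].
  left; exists (add_form X H); last exact/left_add_eq0.
  by apply/in_right_add; left; exists X.
case: IHH => [[X XH X0]|[rH eH]].
  left; exists (add_form G X); last exact/left_add_eq0.
  by apply/in_right_add; right; exists X.
right; split; first exact: (race_add rG rH).
case: eG => [G0'|[X XG [a na rX]]]; last first.
  right; exists (add_form X H); first by apply/in_right_add; left; exists X.
  by exists a => //; rewrite -[a]addn0; apply: (race_add rX rH).
case: eH => [H0'|[X XH [a na rX]]]; first by left; apply/right_add_eq0.
right; exists (add_form G X); first by apply/in_right_add; right; exists X.
by exists a => //; apply: (race_add rG rX).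
Qed.

(** * The bomb universes are absolute *)

Definition bomb_universe (n : nat) : set form :=
  [set G | forall H, follower G H ->
     (left_options H = fset0 -> end_sum n H) /\
     (right_options H = fset0 -> end_sum n (conjugate_form H))].

Lemma bomb_universe_option n G X :
  bomb_universe n G -> is_option G X -> bomb_universe n X.
Proof.
move=> UG GX H XH; apply: UG; apply: (@rt_trans _ _ _ X) => //; exact: rt_step.
Qed.

Lemma bomb_universe_intro n G :
  (forall X, is_option G X -> bomb_universe n X) ->
  (left_options G = fset0 -> end_sum n G) ->
  (right_options G = fset0 -> end_sum n (conjugate_form G)) -> bomb_universe n G.
Proof.
move=> UX Gl Gr H; move/(@clos_rt_rt1n_iff form is_option G H).
case=> [|X K GX /(@clos_rt_rt1n_iff form is_option X K) XK]; first by split.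
exact: UX XK.
Qed.

Lemma dead_ending_bomb_universe n : DeadEnding `<=` bomb_universe n.
Proof.
move=> G dG H GH; have [dl dr] := dG H GH; split=> H0; apply: end_sum_dead.
  exact: dl.
by move=> K /right_follower_conj[K' -> HK]; apply/left_conj_eq0; apply: dr.
Qed.

Lemma bomb_universe_add n G H :
  bomb_universe n G -> bomb_universe n H -> bomb_universe n (add_form G H).
Proof.
move=> UG UH K /follower_add[G' [H' [-> /UG[Gl Gr] /UH[Hl Hr]]]]; split.
  by case/left_add_eq0=> /Gl sG /Hl sH; apply: end_sum_add.
by case/right_add_eq0=> /Gr sG /Hr sH; rewrite conjugate_add; apply: end_sum_add.
Qed.

Lemma bomb_universe_conj n G :
  bomb_universe n G -> bomb_universe n (conjugate_form G).
Proof.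
move=> UG H /follower_conj[K -> /UG[Kl Kr]]; split; first by move/left_conj_eq0.
by move/right_conj_eq0; rewrite conjugate_formK.
Qed.

Lemma parental_bomb_universe n : parental (bomb_universe n).
Proof.
move=> A B A0 B0 UA UB; apply: bomb_universe_intro.
- by move=> X []; rewrite /is_left_option /is_right_option ?left_mkform ?right_mkform;
    [exact: UA|exact: UB].
- by rewrite left_mkform.
- by rewrite right_mkform.
Qed.

Lemma bomb_universe_pos n a : bomb_universe n (pos_form a).
Proof.
elim: a => [|a IHa]; apply: bomb_universe_intro.
- by move=> X []; rewrite /is_left_option /is_right_option ?left_mkform ?right_mkform inE.
- move=> _; apply: end_sum_dead => K /(@clos_rt_rt1n_iff form is_right_option) [].
    by rewrite left_mkform.
  by move=> X ?; rewrite /is_right_option right_mkform inE.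
- move=> _; apply: end_sum_dead => K /(@clos_rt_rt1n_iff form is_right_option) [].
    exact: (left_neg 0).
  by move=> X ? /in_right_neg[].
- by move=> X [] => [/in_left_pos[m [<-] ->]|] //; rewrite /is_right_option right_pos inE.
- by move=> /(@fset0_notin _ (pos_form a)) []; apply/in_left_pos; exists a.
- move=> _; apply: end_sum_dead => K; rewrite -/(neg_form a.+1).
  (* Right moves from a negative integer lead only to negative integers or 0, all of them Left
     ends. *)
  move: (a.+1) => b fK; have [c ->] : exists c, K = neg_form c.
    have [A eA] : exists A, A = neg_form b by exists (neg_form b).
    rewrite -eA in fK; elim: fK b eA => {A K}.
    + by move=> A B AB b eA; move: AB; rewrite eA => /in_right_neg[m _ ->]; exists m.
    + by move=> A b ->; exists b.
    + by move=> A B C _ IH1 _ IH2 b /IH1[c /IH2].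
  exact: left_neg.
Qed.

Lemma absolute_bomb_universe n : absolute_universe (bomb_universe n).
Proof.
split; last exact: parental_bomb_universe.
split=> [|G H|G|G X].
- exact: (@bomb_universe_pos n 0).
- exact: bomb_universe_add.
- exact: bomb_universe_conj.
- exact: bomb_universe_option.
Qed.

Lemma bomb_universe_neg n a : bomb_universe n (neg_form a).
Proof. exact/bomb_universe_conj/bomb_universe_pos. Qed.

Lemma bomb_universe_bomb n N : n <= N -> bomb_universe n (bomb N).
Proof.
move=> nN; apply: bomb_universe_intro.
- move=> X [|/in_right_bomb ->]; last exact: bomb_universe_pos.
  by rewrite /is_left_option left_bomb inE.
- by move=> _; apply: end_sum_bomb.
- by move=> /(@fset0_notin _ (pos_form N)) []; apply/in_right_bomb.
Qed.

Lemma leq_bomb_universe m n : m <= n -> bomb_universe n `<=` bomb_universe m.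
Proof.
by move=> mn G UG H /UG[Hl Hr]; split=> [/Hl|/Hr]; apply: leq_end_sum.
Qed.

(* Whoever moves in this form takes on [M] moves to make; when added to forms *)
(* of smaller depth, it turns misere play into normal play.                   *)
Definition zugzwang (M : nat) : form :=
  mkform [fset pos_form M] [fset neg_form M].

Lemma in_left_zugzwang M X : X \in left_options (zugzwang M) <-> X = pos_form M.
Proof. by rewrite left_mkform inE; split=> /eqP. Qed.

Lemma in_right_zugzwang M X : X \in right_options (zugzwang M) <-> X = neg_form M.
Proof. by rewrite right_mkform inE; split=> /eqP. Qed.

Lemma bomb_universe_zugzwang n M : bomb_universe n (zugzwang M).
Proof.
apply: parental_bomb_universe; first by apply/eqP/fset0Pn; exists (pos_form M); rewrite inE.
- by apply/eqP/fset0Pn; exists (neg_form M); rewrite inE.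
- by move=> X /=; rewrite inE => /eqP ->; apply: bomb_universe_pos.
- by move=> X /=; rewrite inE => /eqP ->; apply: bomb_universe_neg.
Qed.

(** * Separating a bomb from other forms *)

(** If Right moves to -M, Left is stuck and wins. If Right explodes the bomb, Left spends one of the
    n moves, forcing Right to take on -M. *)
Lemma bomb_zugzwang n M : 0 < n -> n <= M ->
  ~ right_wins (add_form (bomb n) (zugzwang M)).
Proof.
case: n => // n _ nM; apply: (@not_right_wins _ (add_form (bomb n.+1) (neg_form M))).
  by apply/in_right_add; right; exists (neg_form M) => //; apply/in_right_zugzwang.
move=> _ /in_right_add[[_ /in_right_bomb -> ->]|[_ /in_right_zugzwang -> ->]]; last first.
  by apply: left_end_wins; apply/left_add_eq0; rewrite left_bomb left_neg.
apply: (@left_winsP _ (add_form (pos_form n) (zugzwang M))).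
  by apply/in_left_add; left; exists (pos_form n) => //; apply/in_left_pos; exists n.
apply: (@not_right_wins _ (add_form (pos_form n) (neg_form M))).
  by apply/in_right_add; right; exists (neg_form M) => //; apply/in_right_zugzwang.
move=> _ /in_right_add[[Y + ->]|[_ /in_right_zugzwang -> ->]]; first by rewrite right_pos inE.
by apply: left_wins_pos_neg; lia.
Qed.

Lemma left_end_zugzwang H M : depth H <= M -> left_options H = fset0 ->
  ~ left_wins (add_form H (zugzwang M)).
Proof.
move=> HM H0; apply: (@not_left_wins _ (add_form H (pos_form M))).
  by apply/in_left_add; right; exists (pos_form M) => //; apply/in_left_zugzwang.
move=> _ /in_left_add[[Y + ->]|[_ /in_left_zugzwang -> ->]]; first by rewrite H0 inE.
by apply: (pos_form_overwhelms H M).2; lia.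
Qed.

(** Right's only move explodes [bomb n]; Left retaliates with the larger bomb, leaving n - M with
    Right to move. *)
Lemma bomb_conj_bomb n M : 0 < n -> n < M ->
  ~ right_wins (add_form (bomb n) (conjugate_form (bomb M))).
Proof.
move=> n0 nM; have cM : right_options (conjugate_form (bomb M)) = fset0.
  exact/right_conj_eq0/left_bomb.
apply: (@not_right_wins _ (add_form (pos_form n) (conjugate_form (bomb M)))).
  by apply/in_right_add; left; exists (pos_form n) => //; apply/in_right_bomb.
move=> _ /in_right_add[[_ /in_right_bomb -> ->]|[Y + ->]]; last by rewrite cM inE.
apply: (@left_winsP _ (add_form (pos_form n) (neg_form M))).
  apply/in_left_add; right; exists (neg_form M) => //; apply/in_left_conj.
  by exists (pos_form M) => //; apply/in_right_bomb.
exact: not_right_wins_pos_neg.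
Qed.

(** Exploding leaves n - n, which Left wins moving first; any other Right move leaves Left stuck at
    once. *)
Lemma bomb_neg n : 0 < n -> ~ right_wins (add_form (bomb n) (neg_form n)).
Proof.
move=> n0; apply: (@not_right_wins _ (add_form (pos_form n) (neg_form n))).
  by apply/in_right_add; left; exists (pos_form n) => //; apply/in_right_bomb.
move=> _ /in_right_add[[_ /in_right_bomb -> ->]|[_ /in_right_neg[m mn ->] ->]].
  exact: left_wins_pos_neg.
by apply: left_end_wins; apply/left_add_eq0; rewrite left_bomb left_neg.
Qed.

Lemma outcome_wins G H : outcome G = outcome H ->
  left_wins G = left_wins H /\ right_wins G = right_wins H.
Proof.
by rewrite /outcome; do 2![case: left_wins; case: right_wins].
Qed.

Lemma not_left_end_distinguishable n N H : left_options H <> fset0 ->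
  distinguishable (bomb_universe n) (bomb N) H.
Proof.
(* The summand n puts [bomb M] in the universe; [depth H] makes M overwhelm whatever remains of
   H. *)
move=> /eqP/fset0Pn[K KH]; pose M := depth H + n.
exists (bomb M) => [|/outcome_wins[eL _]].
  by apply: bomb_universe_bomb; rewrite /M; lia.
suff: ~ left_wins (add_form H (bomb M)).
  by rewrite -eL; apply; apply: left_end_wins; apply/left_add_eq0; rewrite !left_bomb.
apply: (@not_left_wins _ (add_form K (bomb M))).
  by apply/in_left_add; left; exists K.
move=> _ /in_left_add[[L LH ->]|[Y + ->]]; last by rewrite left_bomb inE.
apply: (@right_winsP _ (add_form L (pos_form M))).
  by apply/in_right_add; right; exists (pos_form M) => //; apply/in_right_bomb.
by apply: (pos_form_overwhelms L M).1; have := depth_left LH; rewrite /M; lia.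
Qed.

Lemma bomb_distinguishable n H : 0 < n -> bomb_universe n.+1 H ->
  distinguishable (bomb_universe n) (bomb n) H.
Proof.
move=> n0 UH; case: (EM (left_options H = fset0)) => H0; last first.
  exact: not_left_end_distinguishable.
suff [X UX [nX HX]] : exists2 X, bomb_universe n X &
    ~ right_wins (add_form (bomb n) X) /\ right_wins (add_form H X).
  by exists X => // /outcome_wins[_ eR]; apply: nX; rewrite eR.
have /end_sumP[//|[K KH K0]|[rH [H0'|[K KH [a na rK]]]]] := (UH H (rt_refl _ _ _)).1 H0.
- pose M := depth K + n; exists (zugzwang M); first exact: bomb_universe_zugzwang.
  split; first by apply: bomb_zugzwang; rewrite // /M; lia.
  apply: (@right_winsP _ (add_form K (zugzwang M))).
    by apply/in_right_add; left; exists K.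
  by apply: left_end_zugzwang; rewrite // /M; lia.
- exists (conjugate_form (bomb n.+1)).
    by apply: bomb_universe_conj; apply: bomb_universe_bomb.
  split; first exact: bomb_conj_bomb.
  apply: right_end_wins; apply/right_add_eq0; split=> //.
  exact/right_conj_eq0/left_bomb.
- exists (neg_form n); first exact: bomb_universe_neg.
  split; first exact: bomb_neg.
  apply: (@right_winsP _ (add_form K (neg_form n))).
    by apply/in_right_add; left; exists K.
  (* Here a is at least n + 1, so Left, to move, has strictly more moves than Right's n. *)
  by apply: (race_wins (race_add rK (race_neg n))).1; lia.
Qed.

(** * The chain of universes *)

Lemma distinguishable_sub (U V : set form) G H :
  U `<=` V -> distinguishable U G H -> distinguishable V G H.
Proof. by move=> UV [X /UV VX ne]; exists X. Qed.

Lemma proper_extension_bomb_universe m n :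
  0 < m -> m < n -> proper_extension (bomb_universe n) (bomb_universe m).
Proof.
move=> m0 mn; split; first exact/leq_bomb_universe/ltnW.
exists (bomb m) => [|H UH]; first exact: bomb_universe_bomb.
by apply: bomb_distinguishable => //; apply: leq_bomb_universe UH.
Qed.

Theorem theorem32 :
  exists F : set (set form),
    [/\ infinite_set F,
        forall U : set form, F U ->
          [/\ absolute_universe U,
              DeadEnding `<=` U,
              U `<=` Omega,
              proper_extension DeadEnding U &
              proper_extension U Omega] &
        forall U V : set form, F U -> F V -> U <> V ->
          proper_extension U V \/ proper_extension V U].
Proof.
(* Index 1 is kept out of the family so that [bomb 1] can separate Omega from each member. *)
pose U n := bomb_universe n.+2.
have ltU m n : m < n -> proper_extension (U n) (U m).
  by move=> mn; apply: proper_extension_bomb_universe.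
exists (range U); split.
- have injU : injective U.
    (* If two members coincided, the witness of the proper extension would be distinguishable from
       itself. *)
    move=> m n eU; apply/eqP; apply: contrapT => /negP; rewrite neq_ltn.
    by case/orP=> /ltU [_]; rewrite eU => -[G UG /(_ G UG)[X]].
  rewrite infiniteP; suff : (range U #= [set: nat])%card by rewrite card_eq_le => /andP[].
  by apply: inj_card_eq => m n _ _; apply: injU.
- move=> _ [n _ <-]; split=> //.
  + exact: absolute_bomb_universe.
  + exact: dead_ending_bomb_universe.
  + split; first exact: dead_ending_bomb_universe.
    have [_ [G UG dG]] := ltU n n.+1 (ltnSn n).
    by exists G => // H /(@dead_ending_bomb_universe n.+3); apply: dG.
  + have [_ [G UG dG]] := @proper_extension_bomb_universe 1 n.+2 isT isT.
    by split=> //; exists G => // H /dG; apply: distinguishable_sub.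
- move=> _ _ [m _ <-] [n _ <-] neq.
  by case: (ltngtP m n) => [/ltU|/ltU|emn]; [right|left|rewrite emn in neq].
Qed.
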